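(* Let $G$ be a finite graph and let $\mathcal{V}=\{V_1,\ldots,V_n\}$ be a partition of $V(G)$; write $V_I=\bigcup_{i\in I}V_i$. Each of the following conditions is sufficient for $\mathbf{RG}(\mathcal{I}(G),\mathcal{V})$ to be connected: (a) $\tilde\gamma(G[V_I])\ge 2|I|+1$ for all nonempty $I\subseteq[n]$; (b) $i\gamma(G[V_I])\ge|I|+1$ for all nonempty $I\subseteq[n]$.
   Context: $\mathcal{I}(G)$ is the complex of independent sets of $G$. An independent transversal is an independent set of $G$ containing exactly one vertex from each $V_i$. $\mathbf{RG}(\mathcal{I}(G),\mathcal{V})$ is the graph on the independent transversals, two being adjacent if their union is an independent set of size $n+1$. A vertex set $X$ strongly dominates a vertex set $Y$ if every vertex of $Y$ is adjacent to some vertex of $X$. $\tilde\gamma(H)$ is the minimum size of a set strongly dominating $V(H)$; $i\gamma(H)$ is the minimum integer $\ell$ such that every independent set of $H$ is strongly dominated by some vertex set of size at most $\ell$ (these are $\infty$ if no such set/integer exists). *)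

(* Defs.v *)
From mathcomp Require Import all_boot.
Set Implicit Arguments. Unset Strict Implicit. Unset Printing Implicit Defensive.

(* A finite simple graph: vertex type T : finType, adjacency adj : rel T
   (symmetry and irreflexivity are hypotheses of the theorem).
   Extended naturals N ∪ {∞} are modelled as option nat, None = ∞. *)

Section Defs.
Variables (T : finType) (adj : rel T).

Definition indep (S : {set T}) : bool :=
  [forall x in S, forall y in S, ~~ adj x y].

Definition sdom (X Y : {set T}) : bool :=
  [forall y in Y, exists x in X, adj x y].

Definition least_upto (P : pred nat) : option nat :=
  ohead [seq l <- iota 0 #|T|.+1 | P l].

(* For the induced subgraph H = G[W]:
   tgamma W = minimum size of a vertex set X ⊆ W strongly dominating W (∞ if none).
   Every such X has size <= #|T|, so searching l <= #|T| computes the minimum. *)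
Definition tgamma (W : {set T}) : option nat :=
  least_upto (fun l => [exists X : {set T}, [&& X \subset W, sdom X W & #|X| == l]]).

(* igamma W = minimum l such that every independent set S of G[W] is strongly
   dominated (in G[W]) by some vertex set X ⊆ W with #|X| <= l (∞ if none).
   If some l works then l = #|T| works (X ⊆ W has size <= #|T|) and
   the property is monotone in l, so the bounded search computes the minimum. *)
Definition igamma (W : {set T}) : option nat :=
  least_upto (fun l => [forall S : {set T}, (S \subset W) && indep S ==>
                         [exists X : {set T}, [&& X \subset W, #|X| <= l & sdom X S]]]).

Definition ege (a : option nat) (k : nat) : Prop :=
  match a with None => True | Some m => k <= m end.

Variables (n : nat) (part : T -> 'I_n).
Definition Vpart (i : 'I_n) : {set T} := [set v | part v == i].
Definition VI (I : {set 'I_n}) : {set T} := [set v | part v \in I].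

Definition indep_transversal (S : {set T}) : bool :=
  indep S && [forall i : 'I_n, #|S :&: Vpart i| == 1].

Definition RGadj : rel {set T} := fun A B =>
  [&& indep_transversal A, indep_transversal B,
      indep (A :|: B) & #|A :|: B| == n.+1].

Definition RG_connected : Prop :=
  (exists S, indep_transversal S) /\
  forall A B, indep_transversal A -> indep_transversal B -> connect RGadj A B.

End Defs.

(* Main.v *)
(* Work with augmented mod 2 chains.  Under (a) or (b) every cycle of the
   independence complex of G[V_I] on sets of size at most |I| is a boundary:
   delete an edge uv and compare, as Meshulam does, with G - uv and with
   G - N(u) - N(v), until some vertex is isolated and the complex is a cone.
   For (a) any edge will do; for (b) use an edge uv with u in an independent set
   that is not dominated by |I| vertices.

   Given independent transversals A and B, the maps sending J to the simplices
   A and B restricted to V_J are chain homotopic through chains d_J on V_J.  Let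
   phi count, mod 2, the independent transversals in the component of A.  A
   simplex with n+1 vertices and all n colours has exactly two rainbow facets,
   and these are adjacent in RG, so phi vanishes on boundaries; it also vanishes
   on chains missing a colour.  Hence phi(A) = phi(B), and B lies in the component
   of A.  The same count gives existence, one colour at a time. *)
Require Import Defs.
From mathcomp Require Import all_boot.
From mathcomp Require Import all_algebra.
Set Implicit Arguments. Unset Strict Implicit. Unset Printing Implicit Defensive.

(** * Mod 2 chains, boundary and cone *)

Section Chains.
Import GRing.Theory.
Local Open Scope ring_scope.

(** The orbits of [h] are pairs on which [F] is constant, so each contributes [x + x = 0]; comparing
    ranks selects one element per pair. *)
Lemma sum_involution (I : finType) (V : zmodType) (P : pred I) (F : I -> V)
    (h : I -> I) :
  (forall x : V, x + x = 0) ->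
  (forall x, P x -> [/\ P (h x), h (h x) = x, h x != x & F (h x) = F x]) ->
  \sum_(x | P x) F x = 0.
Proof.
move=> char2 hP.
pose lt x := (enum_rank x < enum_rank (h x))%N.
rewrite (bigID lt) /= [X in _ + X](reindex_onto h h) /=; last first.
  by move=> x /andP[/hP[]].
rewrite [X in _ + X](_ : _ = \sum_(x | P x && lt x) F x) ?char2 //.
apply: eq_big => [x|x /andP[/andP[Ph _] /eqP hx]]; last first.
  by have /hP[] := Ph; rewrite hx.
apply/andP/andP => [[/andP[Phx nlt] /eqP hhx]|[Px ltx]].
  have [Px _ neq _] := hP _ Phx; rewrite hhx in Px neq.
  split=> //; move: nlt; rewrite /lt hhx -leqNgt leq_eqVlt.
  by rewrite (inj_eq val_inj) (inj_eq enum_rank_inj) (negbTE neq).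
have [Phx hhx _ _] := hP _ Px.
by rewrite Phx hhx eqxx /lt hhx -leqNgt ltnW.
Qed.

Lemma addFF2 (x : 'F_2) : x + x = 0.
Proof. by apply/val_inj; case: x => [[|[|]]]. Qed.

Variable T : finType.
Implicit Types (s t S W X Y : {set T}) (u v x y : T).

(* Mod 2 chains on the full simplex over T; a set of size j is a simplex of
   dimension j - 1, and the empty set is included (augmented complex). *)
Definition chain := {ffun {set T} -> 'F_2}.
Implicit Types c d z : chain.

Lemma addcc c : c + c = 0.
Proof. by apply/ffunP=> s; rewrite !ffunE addFF2. Qed.

(** Written through coefficients: a face collects the values of its cofaces, and mod 2 there are no
    signs. *)
Definition bd c : chain := [ffun s : {set T} => \sum_(v | v \notin s) c (v |: s)].
Definition cone v c : chain := [ffun s : {set T} => if v \in s then c (s :\ v) else 0].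
Definition simplex S : chain := [ffun s : {set T} => (s == S)%:R].

Lemma bdD c d : bd (c + d) = bd c + bd d.
Proof.
by apply/ffunP=> s; rewrite !ffunE -big_split; apply: eq_bigr => v _; rewrite ffunE.
Qed.

Lemma bd0 : bd 0 = 0.
Proof. by apply/ffunP=> s; rewrite !ffunE big1 // => v _; rewrite ffunE. Qed.

Lemma bd_sum (I : finType) (P : pred I) (F : I -> chain) :
  bd (\sum_(i | P i) F i) = \sum_(i | P i) bd (F i).
Proof. exact: (big_morph bd bdD bd0). Qed.

Lemma bd_bd c : bd (bd c) = 0.
Proof.
apply/ffunP=> s; rewrite !ffunE.
under eq_bigr do rewrite ffunE.
rewrite pair_big_dep /=.
apply: (sum_involution (h := fun p => (p.2, p.1))) => [|[u v] /=]; first exact: addFF2.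
rewrite !inE !negb_or => /andP[us /andP[vu vs]].
by rewrite us vs (eq_sym u v) vu xpair_eqE (negbTE vu) setUCA.
Qed.

(** Coning with [v] is a chain homotopy from the identity to zero, also on simplices containing [v],
    whose cone is zero. *)
Lemma bd_cone v c : bd (cone v c) = c + cone v (bd c).
Proof.
apply/ffunP=> s; rewrite !ffunE; have [vs|vs] := ifPn.
  rewrite [in RHS](bigD1 v) ?setD11 //= setD1K // addrA addFF2 add0r.
  apply: eq_big => [w|w ws].
    by rewrite !inE; case: (eqVneq w v) => [->|]; rewrite ?vs ?andbT ?andbF.
  rewrite ffunE setU1r //; congr (c _); apply/setP=> x; rewrite !inE.
  by case: (eqVneq x w) => [->|]//=; rewrite andbT; apply: contraNneq ws => ->.
rewrite addr0 (bigD1 v) //= ffunE setU11 setU1K // big1 ?addr0 // => w /andP[ws wv].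
by rewrite ffunE !inE eq_sym (negbTE wv) (negbTE vs).
Qed.

Lemma bd_simplex S : bd (simplex S) = \sum_(v in S) simplex (S :\ v).
Proof.
apply/ffunP=> s; rewrite ffunE sum_ffunE big_mkcond [RHS]big_mkcond /=.
apply: eq_bigr => v _; rewrite !ffunE.
have [vs|vs] := boolP (v \in s); have [vS|vS] := boolP (v \in S) => //=.
- by case: eqP => // es; rewrite es setD11 in vs.
- congr (_ %:R); congr nat_of_bool; apply/eqP/eqP => [<-|->]; first by rewrite setU1K.
  by rewrite setD1K.
- by case: eqP => // es; rewrite -es setU11 in vS.
Qed.

(** * Chains of an independence complex and acyclicity *)

Definition chain_on (adj : rel T) W j c :=
  forall s, c s != 0 -> [/\ s \subset W, indep adj s & #|s| = j].

(** As [j] counts vertices, this is vanishing reduced homology in dimensions up to [k - 1]; for a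
    loopless graph the case [j = 0] says that [W] is nonempty. *)
Definition acyclic adj W k := forall j z, (j <= k)%N -> chain_on adj W j z ->
  bd z = 0 -> exists2 w, chain_on adj W j.+1 w & bd w = z.

Lemma chain_onD adj W j c d :
  chain_on adj W j c -> chain_on adj W j d -> chain_on adj W j (c + d).
Proof.
move=> hc hd s; rewrite ffunE; have [->|/hc //] := eqVneq (c s) 0.
by rewrite add0r => /hd.
Qed.

Lemma chain_on0 adj W j : chain_on adj W j 0.
Proof. by move=> s; rewrite ffunE eqxx. Qed.

Lemma chain_on_sum adj W j (I : finType) (P : pred I) (F : I -> chain) :
  (forall i, P i -> chain_on adj W j (F i)) ->
  chain_on adj W j (\sum_(i | P i) F i).
Proof.
move=> hF; elim/big_ind: _ => //; [exact: chain_on0 | exact: chain_onD].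
Qed.

Lemma chain_on_subset adj W W' j c :
  W \subset W' -> chain_on adj W j c -> chain_on adj W' j c.
Proof. by move=> sWW' hc s /hc[sW ? ?]; split=> //; apply: subset_trans sWW'. Qed.

Lemma indepP (adj : rel T) S :
  reflect {in S &, forall x y, ~~ adj x y} (indep adj S).
Proof.
apply: (iffP forall_inP) => [h x y xS yS|h x xS]; first exact: (forall_inP (h x xS)).
by apply/forall_inP=> y yS; apply: h.
Qed.

Lemma chain_on_cone (adj : rel T) W W' j c v :
  symmetric adj -> irreflexive adj -> v \in W -> W' \subset W ->
  {in W', forall x, ~~ adj v x} ->
  chain_on adj W' j c -> chain_on adj W j.+1 (cone v c).
Proof.
move=> sym irr vW sW'W hv hc s; rewrite ffunE; case: ifP => [vs|_]; last by rewrite eqxx.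
case/hc => sW' ind szs; rewrite (cardsD1 v) vs szs.
have hs x : x \in s -> x != v -> x \in W' /\ x \in s :\ v.
  by move=> xs xv; have xsv : x \in s :\ v by [rewrite !inE xv]; split=> //; apply: (subsetP sW').
split=> //.
  apply/subsetP=> x xs; have [->//|xv] := eqVneq x v.
  by have [xW' _] := hs x xs xv; apply: (subsetP sW'W).
apply/indepP=> x y xs ys; have [->|xv] := eqVneq x v; have [->|yv] := eqVneq y v.
- by rewrite irr.
- by apply: hv; case: (hs y ys yv).
- by rewrite sym; apply: hv; case: (hs x xs xv).
- by apply: (indepP _ _ ind); [case: (hs x xs xv) | case: (hs y ys yv)].
Qed.

(** An isolated vertex can join every independent set, so the complex is a cone with apex [v]. *)
Lemma acyclic_isolated (adj : rel T) W k v :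
  symmetric adj -> irreflexive adj -> v \in W -> {in W, forall x, ~~ adj v x} ->
  acyclic adj W k.
Proof.
move=> sym irr vW hv j z _ hz bdz; exists (cone v z).
  exact: chain_on_cone hz.
rewrite bd_cone bdz; apply/ffunP=> s; rewrite !ffunE; case: ifP => _; by rewrite ?ffunE addr0.
Qed.

(** * Deletion and link of an edge *)

Definition del_edge (adj : rel T) u v : rel T :=
  fun x y => adj x y && ([set x; y] != [set u; v]).

Definition unnbhd (adj : rel T) u v W : {set T} :=
  [set x in W | ~~ adj u x & ~~ adj v x].

Lemma eq_set2 (x y u v : T) :
  ([set x; y] == [set u; v]) = ((x == u) && (y == v)) || ((x == v) && (y == u)).
Proof.
apply/eqP/idP => [/setP e|/orP[]/andP[/eqP-> /eqP->] //]; last exact: setUC.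
move: (e x) (e y) (e u) (e v).
rewrite !inE !eqxx !orbT /= ![u == _]eq_sym ![v == _]eq_sym.
by do 4!case: (_ == _).
Qed.

(* Meshulam's exact sequence argument: the independence complex of G - uv
   arises from that of G by gluing in the join of the edge uv with the
   independence complex of G minus N(u) and N(v). *)
Lemma acyclic_edge (adj : rel T) W k u v :
  symmetric adj -> irreflexive adj -> u \in W -> v \in W -> adj u v ->
  acyclic (del_edge adj u v) W k ->
  (forall k', k = k'.+1 -> acyclic adj (unnbhd adj u v W) k') ->
  acyclic adj W k.
Proof.
move=> sym irr uW vW uv hdel hlink j z jk hz bdz.
have neuv : u != v by apply: contraTneq uv => ->; rewrite irr.
(* Independence survives the removal of an edge, so [z] can be filled there; only simplices of [w]
   containing both [u] and [v] fail to be independent in [adj]. *)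
have [w hw bdw] : exists2 w, chain_on (del_edge adj u v) W j.+1 w & bd w = z.
  apply: hdel => // s /hz[sW ind szs]; split=> //.
  by apply/indepP=> x y xs ys; rewrite negb_and (indepP _ _ ind).
(* [y] is the link of the edge in [w]: the simplices containing [u] and [v], with both removed. *)
pose y : chain := [ffun s : {set T} => if (u \notin s) && (v \notin s) then w (u |: (v |: s)) else 0].
have yP s : y s != 0 -> [/\ s \subset unnbhd adj u v W, indep adj s & #|s|.+1 = j].
  rewrite ffunE; case: ifP; last by rewrite eqxx.
  move=> /andP[us vs] /hw[/subsetP sW /indepP ind szs].
  have ne x : x \in s -> (x != u) && (x != v).
    by move=> xs; apply/andP; split; [apply: contraNneq us | apply: contraNneq vs] => <-.
  split.
  - apply/subsetP=> x xs; rewrite !inE sW ?inE ?xs ?orbT //=.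
    have /andP[xu xv] := ne x xs.
    have := ind u x; have := ind v x; rewrite !inE !eqxx xs !orbT /= /del_edge !eq_set2.
    by rewrite (negbTE xu) (negbTE xv) !andbF /= !andbT => -> // ->.
  - apply/indepP=> x t xs ts; have /andP[xu xv] := ne x xs.
    have := ind x t; rewrite !inE xs ts !orbT /= /del_edge eq_set2.
    by rewrite (negbTE xu) (negbTE xv) /= andbT; apply.
  - by move: szs; rewrite !cardsU1 !inE negb_or neuv us vs => -[].
(* The boundary of [y] reads off [z] on sets containing [u] and [v], which are not independent. *)
have bdy : bd y = 0.
  apply/ffunP=> s; rewrite !ffunE.
  have [/andP[us vs]|nuvs] := boolP ((u \notin s) && (v \notin s)); last first.
    rewrite big1 // => x _; rewrite ffunE; case: ifP => // /andP[].
    by move: nuvs; rewrite !inE !negb_or => h /andP[_ us] /andP[_ vs]; rewrite us vs in h.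
  transitivity (bd w (u |: (v |: s))).
    rewrite ffunE [RHS]big_mkcond /= big_mkcond; apply: eq_bigr => x _.
    rewrite !ffunE !inE !negb_or us vs !andbT ![x == _]eq_sym.
    case: (u == x) => //=; case: (v == x) => //=; rewrite ?andbF ?if_same //.
    case: ifP => // _; congr (w _); apply/setP=> t; rewrite !inE.
    by case: (t == x); case: (t == u); case: (t == v).
  rewrite bdw; apply/eqP; apply: contraTT uv => /hz[_ /indepP ind _].
  by apply: ind; rewrite !inE eqxx ?orbT.
have [x hx bdx] : exists2 x, chain_on adj (unnbhd adj u v W) j x & bd x = y.
  (* Simplices of [y] have [j - 1] vertices, so [y] is zero when [j = 0]; otherwise the link is used
     one level lower. *)
  have [j0|jpos] := posnP j.
    exists 0; first exact: chain_on0.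
    rewrite bd0; apply/ffunP=> s; rewrite ffunE; apply/esym/eqP/negPn/negP=> /yP[_ _].
    by rewrite j0.
  rewrite -(prednK jpos); apply: (hlink k.-1) => //.
  - by rewrite prednK // (leq_trans jpos).
  - by rewrite -!subn1 leq_sub2r.
  - by move=> s /yP[? ? <-].
have sub : unnbhd adj u v W \subset W by apply/subsetP=> t; rewrite inE => /andP[].
(* Adding the boundary of the join of the edge with [x] keeps the boundary [z]; since [bd x = y], it
   cancels the simplices of [w] that contain both [u] and [v]. *)
exists (w + bd (cone u (cone v x))); last by rewrite bdD bd_bd addr0.
have -> : bd (cone u (cone v x)) = cone v x + (cone u x + cone u (cone v y)).
  rewrite bd_cone bd_cone bdx; congr (_ + _); apply/ffunP=> s; rewrite !ffunE.
  by case: ifP => _; rewrite ?addr0 // !ffunE.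
have -> (a b c d : chain) : a + (b + (c + d)) = b + (c + (a + d)).
  by rewrite addrCA; congr (_ + _); rewrite addrCA.
apply: chain_onD; first by apply: chain_on_cone hx => // t; rewrite inE => /and3P[].
apply: chain_onD; first by apply: chain_on_cone hx => // t; rewrite inE => /and3P[].
move=> s; rewrite !ffunE.
have [/andP[us vs]|nuvs] := boolP ((u \in s) && (v \in s)).
  have vsu : v \in s :\ u by rewrite !inE eq_sym neuv.
  by rewrite us vsu (setD1K vsu) (setD1K us) !inE !eqxx andbF addFF2 eqxx.
set r := (if u \in s then _ else _); have -> : r = 0.
  by rewrite /r; move: nuvs; case: ifP => //= us /negbTE vs; rewrite !inE vs andbF.
rewrite addr0 => /hw[sW /indepP ind szs]; split=> //.
apply/indepP=> a b as_ bs; have := ind a b as_ bs.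
rewrite negb_and negbK => /orP[//|]; rewrite eq_set2 => /orP[]/andP[/eqP ea /eqP eb].
  by rewrite -ea -eb as_ bs in nuvs.
by rewrite -ea -eb as_ bs in nuvs.
Qed.

Lemma del_edge_sym (adj : rel T) u v : symmetric adj -> symmetric (del_edge adj u v).
Proof. by move=> sym x y; rewrite /del_edge sym setUC. Qed.

Lemma del_edge_irr (adj : rel T) u v : irreflexive adj -> irreflexive (del_edge adj u v).
Proof. by move=> irr x; rewrite /del_edge irr. Qed.

Definition edges (adj : rel T) W : {set T * T} :=
  [set p | [&& p.1 \in W, p.2 \in W & adj p.1 p.2]].

(** Induction on the number of edges inside [W]: deletion and link both lose [(u, v)]. [P] stands
    for a domination hypothesis that both inherit. *)
Lemma acyclic_ind (P : rel T -> {set T} -> nat -> Prop) :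
  (forall (adj : rel T) W k, symmetric adj -> irreflexive adj -> P adj W k ->
    (exists2 v, v \in W & {in W, forall x, ~~ adj v x}) \/
    (exists u v, [/\ u \in W, v \in W, adj u v, P (del_edge adj u v) W k &
       forall k', k = k'.+1 -> P adj (unnbhd adj u v W) k'])) ->
  forall (adj : rel T) W k, symmetric adj -> irreflexive adj -> P adj W k ->
  acyclic adj W k.
Proof.
move=> step adj W k; have [m] := ubnP #|edges adj W|.
elim: m adj W k => // m IHm adj W k ltm sym irr Pk.
case: (step _ _ _ sym irr Pk) => [[v vW hv]|[u [v [uW vW uv Pdel Plink]]]].
  exact: acyclic_isolated hv.
have uvE : (u, v) \in edges adj W by rewrite inE /= uW vW.
have smaller (E : {set T * T}) : E \subset edges adj W -> (u, v) \notin E -> (#|E| < m)%N.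
  move=> sE nE; rewrite -ltnS; apply: leq_trans ltm; rewrite ltnS.
  by apply: proper_card; apply/properP; split=> //; exists (u, v).
apply: (acyclic_edge sym irr uW vW uv) => [|k' ek].
  apply: IHm => //; [|exact: del_edge_sym|exact: del_edge_irr].
  apply: smaller; last by rewrite inE /= /del_edge eqxx !andbF.
  by apply/subsetP=> -[x y]; rewrite !inE => /and3P[-> -> /andP[->]].
apply: IHm => //; last exact: Plink.
apply: smaller; last by rewrite !inE /= uv !andbF.
by apply/subsetP=> -[x y]; rewrite !inE /= => /and3P[/andP[-> _] /andP[-> _] ->].
Qed.

(** * From strong domination to acyclicity *)

Lemma sdomP (adj : rel T) X Y :
  reflect {in Y, forall y, exists2 x, x \in X & adj x y} (sdom adj X Y).
Proof.
apply: (iffP forall_inP) => h y yY; first exact: (exists_inP (h y yY)).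
exact/exists_inP/h.
Qed.

Lemma sdom_unnbhd (adj : rel T) u v W X Y :
  symmetric adj -> Y \subset W ->
  sdom adj X (Y :&: unnbhd adj u v W) -> sdom adj (u |: (v |: X)) Y.
Proof.
move=> sym sYW /sdomP dom; apply/sdomP=> y yY.
have [uy|nuy] := boolP (adj u y); first by exists u; rewrite ?inE ?eqxx.
have [vy|nvy] := boolP (adj v y); first by exists v; rewrite ?inE ?eqxx ?orbT.
have [|x xX xy] := dom y; first by rewrite !inE yY nuy nvy (subsetP sYW).
by exists x; rewrite // !inE xX !orbT.
Qed.

Lemma sdom_del_edge (adj : rel T) u v X Y : sdom (del_edge adj u v) X Y -> sdom adj X Y.
Proof. by move=> /sdomP dom; apply/sdomP=> y /dom[x xX /andP[xy _]]; exists x. Qed.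

(** Deleting an edge only makes domination harder. A set dominating the link dominates [W] once [u]
    and [v] are added: two vertices for each drop of [k], hence the factor 2. *)
Lemma acyclic_tgamma (adj : rel T) W k :
  symmetric adj -> irreflexive adj ->
  (forall X, X \subset W -> (#|X| <= 2 * k)%N -> ~~ sdom adj X W) ->
  acyclic adj W k.
Proof.
apply: (acyclic_ind (P := fun adj W k =>
  forall X, X \subset W -> (#|X| <= 2 * k)%N -> ~~ sdom adj X W)) => {}adj {}W {}k sym irr hW.
have [v vW|W0] := pickP (mem W); last first.
  have /negP[] : ~~ sdom adj set0 W by apply: hW; rewrite ?sub0set ?cards0.
  by apply/sdomP=> y yW; have := W0 y; rewrite /= yW.
have [/exists_inP[u uW /exists_inP[{vW}v vW uv]]|noedge] :=
    boolP [exists x in W, exists y in W, adj x y]; last first.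
  left; exists v => // x xW; apply: contra noedge => vx.
  by apply/exists_inP; exists v => //; apply/exists_inP; exists x.
right; exists u, v; split=> // [X sXW szX|k' ek X sX szX].
  by apply: contra (hW X sXW szX); apply: sdom_del_edge.
apply: contra (hW (u |: (v |: X)) _ _) => [dom||].
- by apply: (sdom_unnbhd sym (subxx _)); rewrite (setIidPr _) // /unnbhd setIdE subsetIl.
- rewrite !subUset !sub1set uW vW (subset_trans sX) //.
  by apply/subsetP=> x; rewrite inE => /andP[].
- rewrite ek mulnS !cardsU1; apply: leq_trans (_ : 1 + (1 + #|X|) <= _)%N.
    exact: leq_add (leq_b1 _) (leq_add (leq_b1 _) (leqnn _)).
  by rewrite addnA leq_add2l.
Qed.

(** With [u] in the undominated independent set, [u] has no neighbour there, so only [v] has to be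
    added to a set from the link: one vertex for each drop of [k]. *)
Lemma acyclic_igamma (adj : rel T) W S k :
  symmetric adj -> irreflexive adj -> S \subset W -> indep adj S ->
  (forall X, X \subset W -> (#|X| <= k)%N -> ~~ sdom adj X S) ->
  acyclic adj W k.
Proof.
move=> sym irr sSW indS hS.
(* [S] is quantified inside the invariant because the link needs the smaller set
   [S :&: unnbhd adj u v W]. *)
apply: (acyclic_ind (P := fun adj W k => exists S, [/\ S \subset W, indep adj S &
  forall X, X \subset W -> (#|X| <= k)%N -> ~~ sdom adj X S])) => // [|]; last by exists S.
move=> {}adj {}W {}k {}sym {}irr {S sSW indS hS} [S [sSW indS hS]].
have [u uS|S0] := pickP (mem S); last first.
  have /negP[] : ~~ sdom adj set0 S by apply: hS; rewrite ?sub0set ?cards0.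
  by apply/sdomP=> y yS; have := S0 y; rewrite /= yS.
have uW := subsetP sSW u uS.
have [/exists_inP[v vW uv]|noedge] := boolP [exists y in W, adj u y]; last first.
  left; exists u => // x xW; apply: contra noedge => ux.
  by apply/exists_inP; exists x.
right; exists u, v; split=> // [|k' ek].
  exists S; split=> // [|X sX szX].
    by apply/indepP=> x y xS yS; rewrite negb_and (indepP _ _ indS).
  by apply: contra (hS X sX szX); apply: sdom_del_edge.
exists (S :&: unnbhd adj u v W); split=> [||X sX szX]; first exact: subsetIr.
  by apply/indepP=> x y /setIP[xS _] /setIP[yS _]; apply: (indepP _ _ indS).
apply: contra (hS (v |: X) _ _) => [dom||].
- have /sdomP dom' := sdom_unnbhd sym sSW dom.
  apply/sdomP=> y yS; have [x] := dom' y yS; rewrite in_setU1 => /orP[/eqP->|? ?]; last by exists x.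
  by rewrite (negbTE (indepP _ _ indS u y uS yS)).
- rewrite subUset sub1set vW (subset_trans sX) //.
  by apply/subsetP=> x; rewrite inE => /andP[].
- by rewrite ek cardsU1 (leq_add (leq_b1 _)).
Qed.
End Chains.

(** * Acyclic carriers over a simplex *)

Section Colours.
Import GRing.Theory.
Local Open Scope ring_scope.
Variables (T : finType) (adj : rel T).
Implicit Types (s t A B W : {set T}) (u v x y : T) (c d : chain T).

(* e is a chain map from the simplex J0, given on each face, and d is a chain
   homotopy from e to zero carried by W. *)
Lemma acyclic_carrier (I : finType) (W : {set I} -> {set T}) (J0 : {set I})
    (e : {set I} -> chain T) :
  (forall J K : {set I}, J \subset K -> W J \subset W K) ->
  (forall J : {set I}, J \subset J0 -> chain_on adj (W J) #|J| (e J)) ->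
  (forall J : {set I}, J \subset J0 -> bd (e J) = \sum_(i in J) e (J :\ i)) ->
  (exists2 d, chain_on adj (W set0) 1 d & bd d = e set0) ->
  (forall J : {set I}, J \subset J0 -> J != set0 -> acyclic adj (W J) #|J|) ->
  exists d : {set I} -> chain T, forall J : {set I}, J \subset J0 ->
    chain_on adj (W J) #|J|.+1 (d J) /\ bd (d J) = e J + \sum_(i in J) d (J :\ i).
Proof.
move=> Wmono e_on e_bd [d0 d0_on d0_bd] hac.
pose good (d : {set I} -> chain T) J f :=
  chain_on adj (W J) #|J|.+1 f /\ bd f = e J + \sum_(i in J) d (J :\ i).
suff [d hd] : exists d : {set I} -> chain T, forall J : {set I}, J \subset J0 ->
    (#|J| < #|I|.+1)%N -> good d J (d J).
  by exists d => J sJ; apply: hd; rewrite // ltnS max_card.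
elim: #|I|.+1 => [|m [d hd]]; first by exists (fun=> 0).
have /fin_all_exists[f hf] : forall J : {set I}, exists f,
    J \subset J0 -> (#|J| = m)%N -> good d J f.
  move=> J; have [sJ|_] := boolP (J \subset J0); last by exists 0.
  have [szJ|nszJ] := eqVneq #|J| m; last by exists 0 => _ /eqP; rewrite (negbTE nszJ).
  (* No acyclicity is assumed over the empty face; the given [d0] serves there. *)
  have [J_0|J_n0] := eqVneq J set0.
    by exists d0 => _ _; rewrite J_0 /good cards0 big_set0 addr0.
  have hdJ i : i \in J -> good d (J :\ i) (d (J :\ i)).
    move=> iJ; apply: hd; first exact: subset_trans (subsetDl _ _) sJ.
    by rewrite -szJ [X in (_ < X)%N](cardsD1 i) iJ.
  have [||w ? ?] := hac J sJ J_n0 #|J| (e J + \sum_(i in J) d (J :\ i)) (leqnn _).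
  - apply: chain_onD; first exact: e_on.
    apply: chain_on_sum => i iJ; have [hon _] := hdJ i iJ.
    rewrite (cardsD1 i) iJ; apply: chain_on_subset hon; exact/Wmono/subsetDl.
  - rewrite bdD bd_sum e_bd //.
    (* After substitution the [e] terms cancel, and each remaining [d] term occurs twice, once for
       each order of removing [i] and [k]. *)
    rewrite [X in _ + X](eq_bigr (fun i => e (J :\ i) + \sum_(k in J :\ i) d (J :\ i :\ k))).
      rewrite big_split /= addrA addcc add0r pair_big_dep /=.
      apply: (sum_involution (h := fun p => (p.2, p.1))) => [|[i k] /=]; first exact: addcc.
      rewrite !inE => /and3P[iJ ki kJ]; rewrite iJ kJ (eq_sym i k) ki xpair_eqE (negbTE ki).
      by split=> //; congr (d _); rewrite !setDDl setUC.
    by move=> i /hdJ[].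
  - by exists w.
pose d' (J : {set I}) := if (#|J| < m)%N then d J else f J.
exists d' => J sJ ltJ; rewrite /good (eq_bigr (fun i => d (J :\ i))); last first.
  move=> i iJ; rewrite /d'; have -> // : (#|J :\ i| < m)%N.
  by rewrite ltnS (cardsD1 i) iJ in ltJ.
rewrite -/(good d J (d' J)) /d'.
case: ifP => [/hd|/negbT]; first exact.
by rewrite -leqNgt => leJ; apply: hf => //; apply/eqP; rewrite eqn_leq leJ -ltnS ltJ.
Qed.

(** * Rainbow sets and their count on boundaries *)

Variables (n : nat) (part : T -> 'I_n).
Implicit Types (i j : 'I_n) (I J K : {set 'I_n}).

Definition rainbow J s := (s \subset VI part J) && [forall i in J, #|s :&: Vpart part i| == 1%N].

Lemma rainbow_part J s v : rainbow J s -> v \in s -> part v \in J.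
Proof. by move=> /andP[/subsetP h _] /h; rewrite inE. Qed.

Lemma rainbow_inj J s : rainbow J s -> {in s &, injective part}.
Proof.
move=> rb u v us vs e; have uJ := rainbow_part rb us.
have /andP[_ /forall_inP/(_ _ uJ)/cards1P[x hx]] := rb.
have : u \in s :&: Vpart part (part u) by rewrite !inE us eqxx.
have : v \in s :&: Vpart part (part u) by rewrite !inE vs e eqxx.
by rewrite hx !inE => /eqP-> /eqP->.
Qed.

Lemma rainbow_ex J s i : rainbow J s -> i \in J -> exists2 u, u \in s & part u = i.
Proof.
move=> /andP[_ /forall_inP h] /h/cards1P[u hu].
have : u \in s :&: Vpart part i by rewrite hu inE.
by rewrite !inE => /andP[us /eqP]; exists u.
Qed.

Lemma rainbowP J s :
  (forall v, v \in s -> part v \in J) -> {in s &, injective part} ->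
  (forall i, i \in J -> exists2 u, u \in s & part u = i) -> rainbow J s.
Proof.
move=> hp hi he; apply/andP; split; first by apply/subsetP=> v /hp; rewrite inE.
apply/forall_inP=> i /he[u us ui]; apply/cards1P; exists u.
apply/setP=> v; rewrite !inE; apply/andP/eqP => [[vs /eqP vi]|->]; last by rewrite us ui.
by apply: hi; rewrite // ui.
Qed.

Lemma rainbow_sub J K s : rainbow J s -> K \subset J -> rainbow K (s :&: VI part K).
Proof.
move=> rb sK; apply: rainbowP => [v|u v|i iK].
- by rewrite !inE => /andP[].
- by rewrite !inE => /andP[us _] /andP[vs _]; apply: (rainbow_inj rb).
- have [u us ui] := rainbow_ex rb (subsetP sK i iK).
  by exists u; rewrite // !inE us ui.
Qed.

Lemma rainbow_card J s : rainbow J s -> #|s| = #|J|.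
Proof.
move=> rb; rewrite -(card_in_imset (rainbow_inj rb)); congr #|pred_of_set _|.
apply/setP=> i; apply/imsetP/idP => [[v vs ->]|/(rainbow_ex rb)[u]]; last by exists u.
exact: rainbow_part vs.
Qed.

Lemma rainbow_add J s v :
  rainbow J s -> part v \notin J -> rainbow (part v |: J) (v |: s).
Proof.
move=> rb vJ; have ne u : u \in s -> part u != part v.
  by move=> /(rainbow_part rb) uJ; apply: contraNneq vJ => <-.
apply: rainbowP => [u|x y|i].
- by rewrite !inE => /orP[/eqP->|/(rainbow_part rb)->]; rewrite ?eqxx ?orbT.
- rewrite !inE => /orP[/eqP->|xs] /orP[/eqP->|ys] // e.
  + by have := ne y ys; rewrite e eqxx.
  + by have := ne x xs; rewrite e eqxx.
  + exact: (rainbow_inj rb).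
- rewrite !inE => /orP[/eqP->|/(rainbow_ex rb)[u us ui]].
    by exists v; rewrite ?inE ?eqxx.
  by exists u; rewrite // !inE us orbT.
Qed.

Lemma rainbow_swap J s u v : v \notin s ->
  rainbow J s -> u \in s -> part u = part v -> rainbow J ((v |: s) :\ u).
Proof.
move=> vs rb us e; have ne x : x \in s -> x != u -> part x != part v.
  by move=> xs; apply: contraNneq => h; apply/eqP; apply: (rainbow_inj rb) => //; rewrite h.
apply: rainbowP => [x|x y|i /(rainbow_ex rb)[x xs <-]].
- rewrite !inE => /andP[_ /orP[/eqP->|]]; last exact: rainbow_part.
  by rewrite -e (rainbow_part rb).
- rewrite !inE => /andP[xu /orP[/eqP->|xs]] /andP[yu /orP[/eqP->|ys]] // h.
  + by have := ne y ys yu; rewrite h eqxx.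
  + by have := ne x xs xu; rewrite h eqxx.
  + exact: (rainbow_inj rb).
- have [->|xu] := eqVneq x u; last by exists x; rewrite // !inE xu xs orbT.
  by exists v; rewrite // !inE eqxx andbT; apply: contraNneq vs => ->.
Qed.

(** Vertices of a rainbow set correspond to its colours, so restriction to colour sets is a chain
    map. *)
Lemma bd_simplex_rainbow J K s : rainbow J s -> K \subset J ->
  bd (simplex (s :&: VI part K)) = \sum_(i in K) simplex (s :&: VI part (K :\ i)).
Proof.
move=> rb sK; have rbK := rainbow_sub rb sK.
rewrite bd_simplex (partition_big part (mem K)) /=; last by move=> v /(rainbow_part rbK).
apply: eq_bigr => i iK; have [u us ui] := rainbow_ex rbK iK.
rewrite (big_pred1 u) => [|v]; last first.
  apply/andP/eqP => [[vs /eqP vi]|->]; last by rewrite us ui.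
  by apply: (rainbow_inj rbK) => //; rewrite ui.
congr simplex; apply/setP=> v; rewrite !inE.
have [->|vu] := eqVneq v u; first by rewrite ui eqxx andbF.
have [vs|] := boolP (v \in s) => //=; have [vK|] := boolP (part v \in K); last by rewrite andbF.
rewrite andbT; apply/esym; apply: contra vu => /eqP vi; apply/eqP.
by apply: (rainbow_inj rbK); rewrite ?ui // !inE vs.
Qed.

Lemma chain_on_simplex W s : s \subset W -> indep adj s -> chain_on adj W #|s| (simplex s).
Proof. by move=> sW ind t; rewrite ffunE; case: (eqVneq t s) => [->|]; rewrite ?eqxx. Qed.

Lemma indep_sub s t : s \subset t -> indep adj t -> indep adj s.
Proof.
by move=> /subsetP st /indepP ind; apply/indepP=> x y /st xt /st yt; apply: ind.
Qed.

Lemma chain_on_simplex_rainbow J K s : rainbow J s -> indep adj s -> K \subset J ->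
  chain_on adj (VI part K) #|K| (simplex (s :&: VI part K)).
Proof.
move=> rb ind sK; rewrite -(rainbow_card (rainbow_sub rb sK)).
by apply: chain_on_simplex; [exact: subsetIr | exact: indep_sub (subsetIl _ _) ind].
Qed.

(** [s] has a vertex of colour [i], absent from [VI part K]. This kills the lower terms of a
    homotopy when rainbow sets are counted. *)
Lemma rainbow_chain0 J K m c s i :
  rainbow J s -> i \in J -> i \notin K -> chain_on adj (VI part K) m c -> c s = 0.
Proof.
move=> rb iJ iK hc; apply/eqP; apply: contraNT iK => /hc[/subsetP sK _ _].
by have [u /sK + <-] := rainbow_ex rb iJ; rewrite inE.
Qed.

Lemma sum_simplex (C : {set {set T}}) s :
  \sum_(t in C) simplex s t = (s \in C)%:R.
Proof.
rewrite big_mkcond (bigD1 s) //= ffunE eqxx big1 ?addr0; first by case: (s \in C).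
by move=> t ts; rewrite ffunE (negbTE ts) if_same.
Qed.

(* The facets v |: s :\ u of a simplex v |: s lying in C come in pairs, obtained
   by exchanging the two vertices of the only repeated colour. *)
Lemma sum_bd_rainbow J (C : {set {set T}}) d :
  (forall s, s \in C -> rainbow J s) ->
  (forall s v, s \in C -> v \notin s -> d (v |: s) != 0 -> part v \in J /\
     (forall u, u \in s -> part u = part v -> (v |: s) :\ u \in C)) ->
  \sum_(s in C) bd d s = 0.
Proof.
move=> rbC swapC; under eq_bigr do rewrite ffunE.
rewrite pair_big_dep /= (bigID (fun p => d (p.2 |: p.1) != 0)) /=.
rewrite [X in _ + X]big1 ?addr0; last by move=> p /andP[_ /negPn/eqP].
(* The vertex of [s] sharing the colour of [v]; it exists for every pair left in the sum, so the
   default is not reached there. *)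
pose mate (p : {set T} * T) := odflt p.2 [pick u in p.1 | part u == part p.2].
have mateE s u v : s \in C -> u \in s -> part u = part v -> mate (s, v) = u.
  move=> sC us uv; rewrite /mate; case: pickP => [x /andP[xs /eqP xv]|/(_ u)] /=.
    by apply: (rainbow_inj (rbC s sC)) => //; rewrite uv.
  by rewrite us uv eqxx.
apply: (sum_involution (h := fun p => ((p.2 |: p.1) :\ mate p, mate p))); first exact: addFF2.
move=> [s v] /= /andP[/andP[sC vs] dn0].
have [vJ hC] := swapC s v sC vs dn0.
have [u us uv] := rainbow_ex (rbC s sC) vJ.
have neuv : u != v by apply: contraNneq vs => <-.
rewrite (mateE s u v) //=; have tC := hC u us uv.
have eU : u |: (v |: s) :\ u = v |: s by rewrite setD1K // !inE us orbT.
rewrite (mateE _ v u) // ?eU ?tC ?dn0 ?setD11 ?setU1K //; last first.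
  by rewrite !inE eq_sym neuv eqxx.
by split=> //; rewrite xpair_eqE negb_and neuv orbT.
Qed.

(** * From acyclicity to transversals and connectedness *)

Hypothesis hac : forall I, I != set0 -> acyclic adj (VI part I) #|I|.

Lemma VI_mono I J : I \subset J -> VI part I \subset VI part J.
Proof. by move=> /subsetP h; apply/subsetP=> v; rewrite !inE; apply: h. Qed.

(** Induction on the number of colours. If [J] had no such set, the parity of independent rainbow
    sets for [J :\ i] would vanish on the boundary of [d (J :\ i)]; but that boundary is one such
    set plus chains missing a colour. *)
Lemma exists_indep_rainbow J : exists A, rainbow J A && indep adj A.
Proof.
have [m] := ubnP #|J|; elim: m J => // m IHm J ltm.
have [->|[i iJ]] := set_0Vmem J.
  exists set0; apply/andP; split; last by apply/indepP=> x y; rewrite inE.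
  by apply: rainbowP => [v|u v|i]; rewrite inE.
have [|A /andP[rbA indA]] := IHm (J :\ i); first by rewrite (cardsD1 i) iJ in ltm.
apply/existsP; apply: contraT => /existsPn noJ.
(* Allowing colour [i] over every face makes [hac] available over the empty face too, which supplies
   the initial chain. *)
have [||||K sK K0|d hd] := acyclic_carrier (W := fun K => VI part (i |: K))
    (J0 := J :\ i) (e := fun K => simplex (A :&: VI part K)).
- by move=> K L KL; apply/VI_mono/setUS.
- move=> K sK; apply: (chain_on_subset (VI_mono (subsetUr _ _))).
  exact: chain_on_simplex_rainbow rbA indA sK.
- by move=> K sK; apply: bd_simplex_rainbow rbA sK.
- apply: (hac _ (leq0n _)); first by apply/set0Pn; exists i; rewrite !inE eqxx.
    rewrite -(cards0 'I_n); apply: (chain_on_subset (VI_mono (sub0set _))).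
    exact: chain_on_simplex_rainbow rbA indA (sub0set _).
  by rewrite (bd_simplex_rainbow rbA) ?sub0set // big_set0.
- move=> j z jK; apply: hac; first by apply/set0Pn; exists i; rewrite !inE eqxx.
  exact: leq_trans jK (subset_leq_card (subsetUr _ _)).
have [d_on d_bd] := hd _ (subxx _).
pose C := [set s | rainbow (J :\ i) s && indep adj s].
have : \sum_(s in C) bd (d (J :\ i)) s = 0.
  apply: (sum_bd_rainbow (J := J :\ i)) => [s|s v].
    by rewrite inE => /andP[].
  rewrite inE => /andP[rbs inds] vs /d_on[/subsetP sJ ind _].
  (* A vertex of colour [i] would complete [s] to an excluded set for [J]. *)
  have vJ : part v \in J :\ i.
    have := sJ v (setU11 _ _); rewrite inE in_setU1 => /orP[/eqP vi|//].
    have := noJ (v |: s); rewrite ind andbT => /negP[].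
    rewrite -(setD1K iJ) -vi; apply: rainbow_add; first by rewrite vi.
    by rewrite !inE eqxx.
  split=> // u us uv; rewrite inE (rainbow_swap vs rbs us uv) /=.
  exact: indep_sub (subsetDl _ _) ind.
rewrite d_bd; under eq_bigr do rewrite ffunE sum_ffunE.
rewrite big_split /= sum_simplex (setIidPl _); last by case/andP: rbA.
rewrite inE rbA indA /= big1 => [/eqP|s]; first by rewrite addr0.
rewrite inE => /andP[rbs _]; apply: big1 => j jJ.
have [|on _] := hd (J :\ i :\ j); first exact: subsetDl.
apply: (rainbow_chain0 rbs jJ _ on).
by move: jJ; rewrite !inE eqxx /= orbF => /andP[].
Qed.

Lemma rainbow_setT s : rainbow setT s && indep adj s = indep_transversal adj part s.
Proof.
rewrite andbC /indep_transversal /rainbow; congr (_ && _).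
have -> : s \subset VI part setT by apply/subsetP=> v; rewrite !inE.
by apply: eq_forallb => i; rewrite inE.
Qed.

Lemma acyclic_RG_connected : RG_connected adj part.
Proof.
split; first by have [A hA] := exists_indep_rainbow setT; exists A; rewrite -rainbow_setT.
move=> A B tA tB; apply: contraT => nAB.
have := tA; have := tB; rewrite -!rainbow_setT => /andP[rbB indB] /andP[rbA indA].
have [||||K _ K0|d hd] := acyclic_carrier (W := VI part) (J0 := setT)
    (e := fun K => simplex (A :&: VI part K) + simplex (B :&: VI part K)).
- exact: VI_mono.
- by move=> K sK; apply: chain_onD; apply: chain_on_simplex_rainbow (subsetT _).
- by move=> K sK; rewrite bdD !(@bd_simplex_rainbow setT) // -big_split.
(* Over the empty face both restrictions are the empty simplex and cancel mod 2, so the empty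
   [VI part set0] needs no filling. *)
- exists 0; first exact: chain_on0.
  have V0 : VI part set0 = set0 by apply/setP=> v; rewrite !inE.
  by rewrite bd0 V0 !setI0 addcc.
- exact: hac.
have [d_on d_bd] := hd _ (subxx _).
(* [C] is the component of [A]; as [B] lies outside it, the count on the two simplices is one. *)
pose C := [set s | indep_transversal adj part s && connect (RGadj adj part) A s].
have : \sum_(s in C) bd (d setT) s = 0.
  apply: (sum_bd_rainbow (J := setT)) => [s|s v].
    by rewrite inE -rainbow_setT => /andP[/andP[]].
  rewrite inE => /andP[ts As] vs /d_on[_ ind sz]; split=> [|u us uv]; first by rewrite inE.
  have /andP[rbs inds] : rainbow setT s && indep adj s by rewrite rainbow_setT.
  have tt : indep_transversal adj part ((v |: s) :\ u).
    rewrite -rainbow_setT (rainbow_swap vs rbs us uv) /=.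
    exact: indep_sub (subsetDl _ _) ind.
  rewrite inE tt; apply: connect_trans As (connect1 _); apply/and4P; split=> //.
    by apply: indep_sub ind; rewrite subUset subsetUr subsetDl.
  (* The union has [n + 1] vertices, as adjacency in the reconfiguration graph requires. *)
  have -> : s :|: (v |: s) :\ u = v |: s; last by rewrite sz cardsT card_ord.
  apply/setP=> x; rewrite !inE; case: (eqVneq x u) => [->|_] /=; first by rewrite us !orbT.
  by case: (x \in s); rewrite ?orbT ?orbF.
have subVI s : s \subset VI part setT by apply/subsetP=> v; rewrite !inE.
rewrite d_bd; under eq_bigr do rewrite ffunE sum_ffunE ffunE.
rewrite !big_split /= !sum_simplex !(setIidPl (subVI _)) !inE tA tB connect0 (negbTE nAB) /=.
rewrite big1 => [/eqP|s]; first by rewrite !addr0.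
rewrite inE -rainbow_setT => /andP[/andP[rbs _] _]; apply: big1 => j jJ.
have [|on _] := hd (setT :\ j); first exact: subsetDl.
by apply: (rainbow_chain0 rbs jJ _ on); rewrite !inE eqxx.
Qed.
End Colours.

(** * From the domination numbers to acyclicity *)

Lemma least_upto_le (T : finType) (P : pred nat) k l :
  ege (least_upto T P) k -> P l -> l <= #|T| -> k <= l.
Proof.
rewrite /least_upto => hk Pl leT.
have : l \in [seq l <- iota 0 #|T|.+1 | P l] by rewrite mem_filter Pl mem_iota ltnS.
have : sorted leq [seq l <- iota 0 #|T|.+1 | P l].
  exact: (sorted_filter leq_trans _ (iota_sorted _ _)).
case: (filter _ _) hk => //= m r km /(order_path_min leq_trans)/allP h.
by rewrite inE => /orP[/eqP-> //|/h]; apply: leq_trans.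
Qed.

Lemma tgamma_acyclic (T : finType) (adj : rel T) (W : {set T}) k :
  symmetric adj -> irreflexive adj ->
  ege (tgamma adj W) (2 * k + 1) -> acyclic adj W k.
Proof.
move=> sym irr hW; apply: acyclic_tgamma => // X sX szX; apply/negP=> dom.
have : 2 * k + 1 <= #|X|.
  apply: least_upto_le hW _ (max_card _).
  by apply/existsP; exists X; rewrite sX dom eqxx.
by rewrite addn1 ltnNge szX.
Qed.

Lemma igamma_acyclic (T : finType) (adj : rel T) (W : {set T}) k :
  symmetric adj -> irreflexive adj ->
  ege (igamma adj W) (k + 1) -> acyclic adj W k.
Proof.
(* The search for the minimum stops at [#|T|]; no vertex set is larger, so failure at [l] is also
   failure at [k]. *)
move=> sym irr hW; pose l := minn k #|T|.
pose P l := [forall S : {set T}, (S \subset W) && indep adj S ==>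
  [exists X : {set T}, [&& X \subset W, #|X| <= l & sdom adj X S]]].
have [Pl|/forallPn[S]] := boolP (P l).
  have := least_upto_le hW Pl (geq_minr _ _).
  by rewrite addn1 ltnNge geq_minl.
rewrite negb_imply => /andP[/andP[sSW indS] /existsPn noX].
apply: (acyclic_igamma sym irr sSW indS) => X sX szX.
by have := noX X; rewrite sX /l leq_min szX max_card.
Qed.

Theorem theorem6p2 (T : finType) (adj : rel T)
  (adj_sym : symmetric adj) (adj_irr : irreflexive adj)
  (n : nat) (part : T -> 'I_n) :
  ((forall I : {set 'I_n}, I != set0 ->
      ege (tgamma adj (VI part I)) (2 * #|I| + 1)) ->
    RG_connected adj part) /\
  ((forall I : {set 'I_n}, I != set0 ->
      ege (igamma adj (VI part I)) (#|I| + 1)) ->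
    RG_connected adj part).
Proof.
split=> h; apply: acyclic_RG_connected => I /h.
  exact: tgamma_acyclic.
exact: igamma_acyclic.
Qed.
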